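(* Let $\epsilon>0$ be a given accuracy level, let $m\in\mathbb N$ be a fixed order, and let $N(z)>0$, $z\in\mathbb T$, be a given scalar positive spectrum. The trigonometric polynomials $\mathcal P$ and $\mathcal Q$ of order $m$ belong to the $\epsilon$-sublevel set, $(\mathcal P,\mathcal Q)\in\mathscr S_\epsilon$, if and only if there exist real symmetric positive definite matrices $\mathbf P,\mathbf Q$ of size $(m+1)\times(m+1)$ representing them, i.e. $P(z)=\operatorname{tr}(\mathbf P\,\boldsymbol\Theta(z))$ and $Q(z)=\operatorname{tr}(\mathbf Q\,\boldsymbol\Theta(z))$, such that $\operatorname{tr}(\mathbf Q)=1$ and for all $z\in\mathbb T$: 1) $\operatorname{tr}(\mathbf P\,\boldsymbol\Theta(z))-(N(z)+\epsilon)\operatorname{tr}(\mathbf Q\,\boldsymbol\Theta(z))\le0$, 2) $\operatorname{tr}(\mathbf P\,\boldsymbol\Theta(z))-(N(z)-\epsilon)\operatorname{tr}(\mathbf Q\,\boldsymbol\Theta(z))\ge0$.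
   Context: $\mathbb T$ is the complex unit circle. A symmetric trigonometric polynomial $\mathcal P$ of order (at most) $m$ is $P(z)=p_0+\sum_{k=1}^mp_k(z^k+z^{-k})$ with $p_k\in\mathbb R$; $\mathscr T_{m,+}$ is the set of those with $P(z)>0$ for all $z\in\mathbb T$. For such a $\mathcal Q$ with coefficients $q_k$, $\operatorname{tr}(\mathcal Q)=\frac1{2\pi}\int_0^{2\pi}Q(e^{j\omega})\,d\omega=q_0$. The $\epsilon$-sublevel set is $$\mathscr S_\epsilon=\Big\{(\mathcal P,\mathcal Q)\in\mathscr T_{m,+}\times\mathscr T_{m,+}:\ \max_{z\in\mathbb T}\Big|\frac{P(z)}{Q(z)}-N(z)\Big|\le\epsilon,\ \operatorname{tr}(\mathcal Q)=1\Big\}.$$ For $k=-m,\dots,m$, $\boldsymbol\Theta_k\in\mathbb R^{(m+1)\times(m+1)}$ is the primitive Toeplitz matrix with ones on the $k$-th diagonal and zeros elsewhere, and $\boldsymbol\Theta(z)=\sum_{k=-m}^m\boldsymbol\Theta_kz^{-k}$. *)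

(* Defs.v *)
From HB Require Import structures.
From mathcomp Require Import all_boot all_order all_algebra.
From mathcomp Require Import all_classical all_reals all_analysis.
From mathcomp Require Import complex.

Set Implicit Arguments.
Unset Strict Implicit.
Unset Printing Implicit Defensive.

Import Order.TTheory GRing.Theory Num.Theory.
Import numFieldNormedType.Exports.

Local Open Scope classical_set_scope.
Local Open Scope ring_scope.
Local Open Scope complex_scope.

Definition unit_circle (R : realType) : set R[i] := [set z | `|z| = 1].

(* A symmetric trigonometric polynomial of order (at most) m is given by its
   real coefficients p_0, ..., p_m. *)
Definition trigpoly (R : realType) (m : nat) := 'rV[R]_m.+1.

Definition tp_eval (R : realType) (m : nat) (p : trigpoly R m) (z : R[i])
    : R[i] :=
  (p 0 ord0)%:C
  + \sum_(k < m.+1 | (0 < k)%N) (p 0 k)%:C * (z ^+ k + z ^- k).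

(* In R[i], [0 < w] means that w is real and positive. *)
Definition tp_pos (R : realType) (m : nat) : set (trigpoly R m) :=
  [set p | forall z, unit_circle z -> 0 < tp_eval p z].

Definition expj (R : realType) (w : R) : R[i] := cos w +i* sin w.

(* tp_eval q takes real values on the unit circle, hence the real part. *)
Definition tp_tr (R : realType) (m : nat) (q : trigpoly R m) : R :=
  (2 * pi)^-1 *
  \int[lebesgue_measure]_(w in `[0, 2 * pi]) complex.Re (tp_eval q (expj w)).

(* max_{z in T} |P(z)/Q(z) - N(z)|, as a supremum in the extended reals: it is
   the maximum whenever the latter exists (e.g. for N continuous), and +oo
   when the error is unbounded, so that no regularity of N is needed. *)
Definition max_error (R : realType) (m : nat) (N : R[i] -> R)
    (p q : trigpoly R m) : \bar R :=
  ereal_sup [set (complex.Re `|tp_eval p z / tp_eval q z - (N z)%:C|)%:E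
            | z in @unit_circle R].

Definition sublevel (R : realType) (m : nat) (N : R[i] -> R) (eps : R)
    : set (trigpoly R m * trigpoly R m) :=
  [set pq | [/\ tp_pos pq.1, tp_pos pq.2,
                (max_error N pq.1 pq.2 <= eps%:E)%E & tp_tr pq.2 = 1]].

(* Ones at the positions (i, j) with j - i = k. *)
Definition Theta_k (R : realType) (m : nat) (k : int) : 'M[R]_m.+1 :=
  \matrix_(i, j) ((j%:Z - i%:Z == k)%:R).

(* The index k = l - m runs over -m, ..., m. *)
Definition Theta (R : realType) (m : nat) (z : R[i]) : 'M[R[i]]_m.+1 :=
  \sum_(l < (2 * m).+1)
    let k := l%:Z - m%:Z in
    z ^ (- k) *: map_mx (real_complex R) (Theta_k R m k).

Definition tr_Theta (R : realType) (m : nat) (A : 'M[R]_m.+1) (z : R[i])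
    : R[i] :=
  \tr (map_mx (real_complex R) A *m Theta m z).

Definition sym_posdef (R : realType) (n : nat) (A : 'M[R]_n) : Prop :=
  A^T = A /\ forall x : 'cV[R]_n, x != 0 -> 0 < (x^T *m A *m x) 0 0.

Definition represents (R : realType) (m : nat) (A : 'M[R]_m.+1)
    (p : trigpoly R m) : Prop :=
  forall z, unit_circle z -> tp_eval p z = tr_Theta A z.

(* Main.v *)
Require Import Defs.
From HB Require Import structures.
From mathcomp Require Import all_boot all_order all_algebra.
From mathcomp Require Import all_classical all_reals all_analysis.
From mathcomp Require Import complex.
From mathcomp Require Import ring lra.

Set Implicit Arguments.
Unset Strict Implicit.
Unset Printing Implicit Defensive.

Import Order.TTheory GRing.Theory Num.Theory.
Import numFieldNormedType.Exports.

Local Open Scope classical_set_scope.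
Local Open Scope ring_scope.
Local Open Scope complex_scope.

(** The condition on the ratio is elementary: where [Q] is positive,
    [|P/Q - N| <= eps] is the pair of inequalities obtained by multiplying by
    [Q] ([max_error_le]).  What remains is to relate positivity of a
    trigonometric polynomial to positive definite Gram matrices, and its mean
    to the trace of such a matrix.

    If [A] represents [p] then, with [v = (1, z, ..., z^m)] and [|z| = 1],
    [p(z) = v^* A v = x^T A x + y^T A y], where [x] and [y] are the real and
    imaginary parts of [v].  As [x_0 = 1], this is positive when [A] is positive
    definite ([sym_posdef_tp_pos]).  Averaging the same formula over the circle
    kills the off-diagonal terms, so [tp_tr p] is the trace of any matrix that
    represents [p] ([represents_tr]).

    Conversely let [p > 0] on the circle.  By Chebyshev's recurrence
    [p(z) = t(Re z)] for a real polynomial [t] of degree at most [m]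
    ([tp_evalE]), and [t] is positive on the compact interval [[-1, 1]], so
    [t - c (m + 1)] is still positive there for some [c > 0].  The Fejer-Riesz
    theorem writes it as [|h(z)|^2] with [h] a real polynomial of degree at most
    [m].  The identity matrix represents the constant [m + 1], hence
    [h h^T + c I] represents [p], and it is positive definite thanks to the
    second term ([posdef_gram_exists]).

    Fejer-Riesz is proved in the variable [x = Re z] rather than by pairing the
    roots of [z^m p(z)].  A complex root [w] of [t] is written
    [w = (r + 1/r) / 2]; on the circle, [2 |r| |Re z - w| = |z - r| |z - r'|]
    ([norm_Joukowski]), where [r'] is the conjugate of [r].  A real root outside
    [[-1, 1]] has a real [r], and gives [|z - r|^2]; a pair of conjugate roots
    gives [|(z - r)(z - r')|^2], where [(z - r)(z - r')] has real coefficients.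
    Peeling off real factors of [t] one at a time yields the real [h]. *)

(** * Means over the unit circle *)

Lemma is_derive1_big_sum (R : realType) (I : Type) (s : seq I)
    (f : I -> R -> R) (df : I -> R) (x : R) :
  (forall i, is_derive x 1 (f i) (df i)) ->
  is_derive x 1 (fun w => \sum_(i <- s) f i w) (\sum_(i <- s) df i).
Proof.
move=> fdf; elim: s => [|i s IHs].
  rewrite big_nil (_ : (fun _ => _) = cst 0); first exact: is_derive_cst.
  by apply/funext => w; rewrite big_nil.
rewrite big_cons (_ : (fun _ => _) = f i + (fun w => \sum_(j <- s) f j w)).
  exact: is_deriveD.
by apply/funext => w; rewrite big_cons.
Qed.

(** The hypothesis says that the frequencies [d i] are half-integers, so that
    each antiderivative [sin (d i * w) / d i] vanishes at both ends of the
    period.  Only the zero frequencies contribute. *)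
Lemma mean_cos_sum (R : realType) (I : finType) (a d : I -> R) :
  (forall i, sin (d i * (2 * pi)) = 0) ->
  (2 * pi)^-1 * \int[lebesgue_measure]_(w in `[0, 2 * pi])
     (\sum_i a i * cos (d i * w))
  = \sum_(i | d i == 0) a i.
Proof.
move=> sin_d; have pi2_gt0 : 0 < 2 * pi :> R by rewrite mulr_gt0 ?pi_gt0.
have d_cos (c x : R) :
    is_derive x 1 (fun w : R => cos (c * w)) (- c * sin (c * x)).
  have -> : (fun w : R => cos (c * w)) = cos \o ( *%R c) by [].
  rewrite mulNr mulrC -mulNr; apply: is_derive1_comp.
  by apply: is_derive_eq; rewrite /GRing.scale/= mulr1.
pose F i (w : R) := if d i == 0 then a i * w else a i / d i * sin (d i * w).
have dF i (x : R) : is_derive x 1 (F i) (a i * cos (d i * x)).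
  rewrite /F; case: eqP => [->|/eqP d_neq0].
    by apply: is_derive_eq; rewrite /GRing.scale/= mul0r cos0.
  rewrite (_ : (fun w => _) = (a i / d i) \*: (sin \o ( *%R (d i)))) //.
  have dsin : is_derive x 1 (sin \o ( *%R (d i))) (cos (d i * x) * d i).
    apply: is_derive1_comp.
    by apply: is_derive_eq; rewrite /GRing.scale/= mulr1.
  by apply: is_derive_eq; rewrite /GRing.scale/=; field.
have dsum (x : R) := is_derive1_big_sum (index_enum I) (fun i => dF i x).
pose f (w : R) := \sum_i a i * cos (d i * w).
pose G (w : R) := \sum_i F i w; rewrite -/G in dsum.
have cG : continuous G.
  by move=> x; apply/differentiable_continuous/derivable1_diffP.
have cf : continuous f.
  move=> y; apply/differentiable_continuous/derivable1_diffP.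
  pose df i (x : R) := a i * (- d i * sin (d i * x)).
  have dcos (x : R) i : is_derive x 1 (fun w => a i * cos (d i * w)) (df i x).
    rewrite (_ : (fun w => _) = a i \*: (fun w => cos (d i * w))) //.
    exact: is_deriveZ.
  by case: (is_derive1_big_sum (index_enum I) (dcos y)).
rewrite /Rintegral (@continuous_FTC2 _ f G) //=; last 3 first.
- exact: continuous_subspaceT.
- split => [x _||]; first by case: (dsum x).
    by apply: cvg_at_right_filter; exact: cG.
  by apply: cvg_at_left_filter; exact: cG.
- by move=> x _; rewrite derive1E; exact: derive_val.
rewrite /G -sumrB mulr_sumr [RHS]big_mkcond/=; apply: eq_bigr => i _.
rewrite /F; case: eqP => _; first
  by rewrite mulr0 subr0 mulrCA mulVf ?mulr1// gt_eqF.
by rewrite sin_d !mulr0 sin0 !mulr0 subr0 mulr0.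
Qed.

Lemma expjX (R : realType) (w : R) (k : nat) :
  expj w ^+ k = expj (k%:R * w).
Proof.
elim: k => [|k IHk]; first by rewrite expr0 mul0r /expj cos0 sin0.
rewrite exprS IHk -natr1 mulrDl mul1r addrC /expj cosD sinD.
by apply/eqP; rewrite eq_complex /=; apply/andP; split; apply/eqP; ring.
Qed.

Lemma norm_expj (R : realType) (w : R) : unit_circle (expj w).
Proof. by rewrite /unit_circle/= normc_def /= cos2Dsin2 sqrtr1. Qed.

Lemma sin_nat_2pi (R : realType) (k : nat) : sin (k%:R * (2 * pi)) = 0 :> R.
Proof.
have := expjX (2 * pi : R) k.
by rewrite /expj mulr_natl cos2pi sin2pi expr1n => -[].
Qed.

(** * Symmetric trigonometric polynomials as polynomials in Re z *)

Lemma unit_circleE (R : realType) (z : R[i]) :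
  unit_circle z -> (complex.Re z) ^+ 2 + (complex.Im z) ^+ 2 = 1.
Proof.
move=> z1; apply: complexI; rewrite add_Re2_Im2.
by move: z1; rewrite /unit_circle/= => ->; rewrite expr1n.
Qed.

Lemma unit_circleV (R : realType) (z : R[i]) : unit_circle z -> z^-1 = z^*%C.
Proof.
by rewrite /unit_circle/= invc_norm => ->; rewrite expr1n invr1 mul1r.
Qed.

Lemma unit_circle_neq0 (R : realType) (z : R[i]) : unit_circle z -> z != 0.
Proof. by rewrite /unit_circle/= -normr_gt0 => ->. Qed.

Lemma unit_circle_Re (R : realType) (z : R[i]) :
  unit_circle z -> -1 <= complex.Re z <= 1.
Proof. by move/unit_circleE => z1; apply/andP; split; nra. Qed.

Lemma complex_ReK (R : realType) (z : R[i]) :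
  complex.Im z = 0 -> z = (complex.Re z)%:C.
Proof. by case: z => x y /= ->. Qed.

Lemma tp_eval_real (R : realType) (m : nat) (p : trigpoly R m) (z : R[i]) :
  unit_circle z -> complex.Im (tp_eval p z) = 0.
Proof.
move=> z1; rewrite /tp_eval raddfD /= add0r raddf_sum /= big1 // => k _.
rewrite -exprVn (unit_circleV z1) -rmorphXn/= addcJ.
by rewrite /= !(mul0r, mulr0, add0r, addr0).
Qed.

(** Twice the Chebyshev polynomial of the first kind: on the circle
    [z + 1/z = 2 Re z], and [z^(k+2) + z^-(k+2) =
    (z + 1/z) (z^(k+1) + z^-(k+1)) - (z^k + z^-k)]. *)
Lemma chebyshev (R : realType) (k : nat) :
  exists2 t : {poly R}, (size t <= k.+1)%N &
    forall z : R[i], unit_circle z -> z ^+ k + z ^- k = (t.[complex.Re z])%:C.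
Proof.
(* The recurrence has depth two, so the induction carries two consecutive
   polynomials. *)
suff [t []] : exists t : {poly R},
    [/\ (size t <= k.+1)%N,
      forall z : R[i], unit_circle z -> z ^+ k + z ^- k = (t.[complex.Re z])%:C
    & exists2 u : {poly R}, (size u <= k.+2)%N &
      forall z : R[i], unit_circle z ->
        z ^+ k.+1 + z ^- k.+1 = (u.[complex.Re z])%:C].
  by exists t.
have zV (z : R[i]) : unit_circle z -> z + z^-1 = (2 * complex.Re z)%:C.
  by move=> z1; rewrite (unit_circleV z1) addcJ rmorphM rmorph_nat.
elim: k => [|k [t [st tE [u su uE]]]].
  exists 2%:P; split => [|z z1|]; first exact: size_polyC_leq1.
    by rewrite expr0 invr1 hornerC rmorph_nat.
  exists (2%:P * 'X); first by rewrite size_Cmul ?size_polyX ?pnatr_eq0.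
  by move=> z z1; rewrite !hornerE -zV.
exists u; split => //; exists (2%:P * ('X * u) - t).
  rewrite (leq_trans (size_polyD _ _))// geq_max size_polyN.
  rewrite (leq_trans st) ?andbT//; last by rewrite leqW.
  rewrite size_Cmul ?pnatr_eq0//.
  by rewrite (leq_trans (size_polyMleq _ _))// size_polyX /= ltnS.
move=> z z1; rewrite hornerD hornerN hornerCM hornerM hornerX mulrA.
rewrite rmorphB rmorphM /=.
rewrite -(tE z z1) -(uE z z1) -(zV z z1); have z0 := unit_circle_neq0 z1.
by rewrite -!exprVn !exprS; field.
Qed.

Lemma tp_evalE (R : realType) (m : nat) (p : trigpoly R m) :
  exists2 t : {poly R}, (size t <= m.+1)%N &
    forall z : R[i], unit_circle z -> tp_eval p z = (t.[complex.Re z])%:C.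
Proof.
pose t k := s2val (cid2 (chebyshev R k)).
have szt k : (size (t k) <= k.+1)%N by rewrite /t; case: cid2.
exists ((p 0 ord0)%:P + \sum_(k < m.+1 | (0 < k)%N) p 0 k *: t k).
  rewrite (leq_trans (size_polyD _ _))// geq_max.
  rewrite (leq_trans (size_polyC_leq1 _))//=.
  rewrite (leq_trans (size_sum _ _ _))//; apply/bigmax_leqP => k _.
  by rewrite (leq_trans (size_scale_leq _ _))// (leq_trans (szt k)).
move=> z z1; rewrite hornerD hornerC horner_sum rmorphD rmorph_sum.
congr (_ + _); apply: eq_bigr => k _.
by rewrite hornerZ rmorphM /t; case: cid2 => /= u _ <-.
Qed.

(** * Gram matrices *)

Lemma ThetaE (R : realType) (m : nat) (z : R[i]) (i j : 'I_m.+1) :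
  z != 0 -> Theta m z i j = z ^+ i / z ^+ j.
Proof.
move=> z0; have lt_ij : (j + m - i < (2 * m).+1)%N.
  by rewrite ltnS mul2n -addnn (leq_trans (leq_subr _ _))// leq_add2r leq_ord.
rewrite /Theta summxE (bigD1 (Ordinal lt_ij))//= !mxE big1 => [|l neq_l].
  have -> : (j + m - i)%N%:Z - m%:Z = j%:Z - i%:Z.
    have im : (i <= j + m)%N by rewrite (leq_trans (leq_ord i))// leq_addl.
    by rewrite -subzn// PoszD; ring.
  by rewrite eqxx rmorph1 mulr1 addr0 opprB expfzDr// -exprnN.
rewrite !mxE [_ == _](_ : _ = false) ?rmorph0 ?mulr0//.
apply/negbTE; apply: contra neq_l => /eqP jil; apply/eqP/val_inj => /=.
have : (l + i)%N%:Z = (j + m)%N%:Z.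
  by rewrite !PoszD; apply/eqP; rewrite -subr_eq0; apply/eqP; lra.
by case=> <-; rewrite addnK.
Qed.

(** The trace is the Hermitian form [v^* A v] at [v = (1, z, ..., z^m)], because
    [1/z] is the conjugate of [z] on the circle. *)
Lemma tr_ThetaE (R : realType) (m : nat) (A : 'M[R]_m.+1) (z : R[i]) :
  unit_circle z ->
  tr_Theta A z = \sum_i \sum_j (A i j)%:C * ((z ^+ i)^*%C * z ^+ j).
Proof.
move=> z1; apply: eq_bigr => i _; rewrite mxE; apply: eq_bigr => j _.
rewrite mxE ThetaE ?unit_circle_neq0// -exprVn unit_circleV// rmorphXn/=.
by rewrite [z ^+ j * _]mulrC.
Qed.

Lemma Re_tr_ThetaE (R : realType) (m : nat) (A : 'M[R]_m.+1) (z : R[i]) :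
  unit_circle z ->
  complex.Re (tr_Theta A z) = \sum_i \sum_j A i j *
    (complex.Re (z ^+ i) * complex.Re (z ^+ j)
     + complex.Im (z ^+ i) * complex.Im (z ^+ j)).
Proof.
move=> z1; rewrite tr_ThetaE// raddf_sum; apply: eq_bigr => i _.
rewrite raddf_sum; apply: eq_bigr => j _.
by case: (z ^+ i) => a b; case: (z ^+ j) => c d /=; ring.
Qed.

Lemma quadratic_formE (R : realType) (n : nat) (A : 'M[R]_n) (x : 'cV[R]_n) :
  (x^T *m A *m x) 0 0 = \sum_i \sum_j A i j * (x i 0 * x j 0).
Proof.
rewrite mxE exchange_big; apply: eq_bigr => j _; rewrite mxE mulr_suml.
by apply: eq_bigr => i _; rewrite mxE; ring.
Qed.

(** For real [A] the real part of [v^* A v] is the sum of the values of the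
    quadratic form at the real and imaginary parts of [v]. *)
Lemma sym_posdef_tp_pos (R : realType) (m : nat) (A : 'M[R]_m.+1)
    (p : trigpoly R m) :
  sym_posdef A -> represents A p -> tp_pos p.
Proof.
move=> [_ A_gt0] Ap z z1; rewrite ltcE tp_eval_real//= eqxx/= Ap//.
pose x : 'cV[R]_m.+1 := \col_i complex.Re (z ^+ i).
pose y : 'cV[R]_m.+1 := \col_i complex.Im (z ^+ i).
have -> : complex.Re (tr_Theta A z) = (x^T *m A *m x) 0 0 + (y^T *m A *m y) 0 0.
  rewrite Re_tr_ThetaE// !quadratic_formE -big_split; apply: eq_bigr => i _.
  by rewrite -big_split; apply: eq_bigr => j _; rewrite !mxE /= -mulrDr.
(* The entry of index 0 of [x] is 1. *)
have x_neq0 : x != 0.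
  apply/eqP => /matrixP/(_ 0 0); rewrite !mxE expr0 /= => /eqP.
  by rewrite oner_eq0.
rewrite ltr_wpDr ?A_gt0//.
have [->|y_neq0] := eqVneq y 0; first by rewrite mulmx0 mxE.
by rewrite ltW// A_gt0.
Qed.

(** At [z = exp(jw)] the term [(i, k)] of [v^* A v] has real part
    [A i k * cos ((i - k) w)], so that only the diagonal survives in the mean. *)
Lemma represents_tr (R : realType) (m : nat) (A : 'M[R]_m.+1)
    (p : trigpoly R m) :
  represents A p -> tp_tr p = \tr A.
Proof.
move=> Ap; pose a (ij : 'I_m.+1 * 'I_m.+1) := A ij.1 ij.2.
pose d (ij : 'I_m.+1 * 'I_m.+1) : R := (ij.1 : nat)%:R - (ij.2 : nat)%:R.
rewrite /tp_tr (_ : (fun w => _) = fun w => \sum_ij a ij * cos (d ij * w)).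
  rewrite mean_cos_sum => [|ij].
    rewrite /mxtrace; under eq_bigl => ij do rewrite subr_eq0 eqr_nat.
    rewrite -(pair_big_dep xpredT (fun i j : 'I_m.+1 => i == j :> nat) A)/=.
    apply: eq_bigr => i _; under eq_bigl do rewrite eq_sym.
    by rewrite big_pred1_eq.
  by rewrite mulrBl sinB !sin_nat_2pi !mul0r mulr0 subr0.
apply/funext => w; rewrite Ap ?Re_tr_ThetaE; try exact: norm_expj.
rewrite pair_big; apply: eq_bigr => -[i j] _ /=.
by rewrite !expjX /= -cosB -mulrBl.
Qed.

(** The matrix [h h^T + c I], where [h] is seen as its vector of coefficients. *)
Definition gram (R : realType) (m : nat) (h : {poly R}) (c : R) : 'M[R]_m.+1 :=
  \matrix_(i, j) (h`_i * h`_j + c * (i == j)%:R).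

(** The bilinear form of [gram m h c] after extension of scalars by [f]: with the
    identity it gives the real quadratic form, with the embedding of the reals
    and [u = v^*] it gives the Hermitian form on the circle. *)
Lemma gram_sum (R : realType) (S : comNzRingType) (m : nat)
    (f : {rmorphism R -> S}) (h : {poly R}) (c : R) (u v : 'I_m.+1 -> S) :
  \sum_i \sum_j f (gram m h c i j) * (u i * v j) =
  (\sum_(i < m.+1) f h`_i * u i) * (\sum_(j < m.+1) f h`_j * v j)
  + f c * \sum_i u i * v i.
Proof.
rewrite mulr_suml mulr_sumr -big_split; apply: eq_bigr => i _ /=.
under eq_bigr do rewrite mxE rmorphD !rmorphM rmorph_nat mulrDl.
rewrite big_split mulr_sumr /=; congr (_ + _).
  by apply: eq_bigr => j _; ring.
rewrite (bigD1 i)//= eqxx mulr1 big1 ?addr0// => j /negbTE neq_ij.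
by rewrite eq_sym neq_ij mulr0 mul0r.
Qed.

Lemma gram_sym_posdef (R : realType) (m : nat) (h : {poly R}) (c : R) :
  0 < c -> sym_posdef (gram m h c).
Proof.
move=> c_gt0; split=> [|x x_neq0].
  by apply/matrixP => i j; rewrite !mxE eq_sym mulrC.
rewrite quadratic_formE (gram_sum idfun) /= -expr2.
have [i xi0] : exists i, x i 0 != 0.
  apply/existsP; apply: contraR x_neq0; rewrite negb_exists => /forallP x0.
  apply/eqP/matrixP => i j; rewrite ord1 mxE; apply/eqP.
  by rewrite -[_ == _]negbK.
apply: ltr_wpDl; first exact: sqr_ge0.
rewrite mulr_gt0// (bigD1 i)//= ltr_wpDr//.
  by rewrite sumr_ge0// => j _; rewrite -expr2 sqr_ge0.
by rewrite -expr2 exprn_even_gt0.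
Qed.

Lemma tr_Theta_gram (R : realType) (m : nat) (h : {poly R}) (c : R) (z : R[i]) :
  (size h <= m.+1)%N -> unit_circle z ->
  tr_Theta (gram m h c) z =
  `|(map_poly (real_complex R) h).[z]| ^+ 2 + (c * m.+1%:R)%:C.
Proof.
move=> sh z1; rewrite tr_ThetaE// (gram_sum (real_complex R)); congr (_ + _).
  rewrite sqr_normc (horner_coef_wide _ (n := m.+1)) ?size_map_poly// mulrC.
  under [in RHS]eq_bigr do rewrite coef_map/=.
  congr (_ * _); rewrite rmorph_sum; apply: eq_bigr => i _.
  by rewrite rmorphM; congr (_ * _); rewrite /= oppr0.
rewrite rmorphM rmorph_nat; congr (_ * _).
under eq_bigr do rewrite mulrC -sqr_normc normrX z1 !expr1n.
by rewrite sumr_const card_ord.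
Qed.

(** * The Fejer-Riesz factorization *)

(** The equation is [w = (r + 1/r) / 2], cleared of denominators.  The product of
    its two solutions is 1, hence neither vanishes. *)
Lemma complex_quadratic_root (R : realType) (w : R[i]) :
  exists2 r : R[i], r != 0 & r ^+ 2 + 1 = 2 * w * r.
Proof.
pose s := sqrtc (w ^+ 2 - 1); have sE : s ^+ 2 = w ^+ 2 - 1 := sqr_sqrtc _.
exists (w + s); last by ring: sE.
apply/eqP => ws0; have : (w + s) * (w - s) = 1 by ring: sE.
by rewrite ws0 mul0r => /esym/eqP; rewrite oner_eq0.
Qed.

(** Clearing denominators, [2 r z (Re z - w) = (z - r) (r z - 1)] on the circle,
    and [|r z - 1| = |r - 1/z| = |r - z^*|]. *)
Lemma norm_Joukowski (R : realType) (z w r : R[i]) :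
  unit_circle z -> r ^+ 2 + 1 = 2 * w * r ->
  2 * `|r| * `|(complex.Re z)%:C - w| = `|z - r| * `|z - r^*%C|.
Proof.
move=> z1 rw; have z0 := unit_circle_neq0 z1.
have -> : `|z - r^*%C| = `|r * z - 1|.
  rewrite -[LHS]normcJ rmorphB /= conjcK -unit_circleV//.
  rewrite -[LHS]mul1r -[in LHS]z1 -normrM mulrBr mulfV// -normrN opprB.
  by rewrite mulrC.
have zz : z ^+ 2 + 1 = 2 * (complex.Re z)%:C * z.
  rewrite -[2 * _]addcJ -unit_circleV// mulrDl mulVf// expr2.

rewrite -normrM (_ : (z - r) * _ = 2 * r * z * ((complex.Re z)%:C - w)).
  by rewrite !normrM z1 mulr1 normr_nat.
transitivity (r * (z ^+ 2 + 1) - z * (r ^+ 2 + 1)); first by ring.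
by rewrite zz rw; ring.
Qed.

(** Outside [[-1, 1]] the discriminant of [X^2 - 2 a X + 1] is nonnegative. *)
Lemma real_quadratic_root (R : realType) (a : R) :
  ~~ (-1 <= a <= 1) -> exists2 r : R, r != 0 & r ^+ 2 + 1 = 2 * a * r.
Proof.
move=> a_out; have a2 : 0 <= a ^+ 2 - 1.
  by move: a_out; rewrite negb_and -!ltNge => /orP[] ?; nra.
have sE := sqr_sqrtr a2; set s := Num.sqrt _ in sE.
exists (a + s); last by ring: sE.
apply/eqP => ws0; have : (a + s) * (a - s) = 1 by ring: sE.
by rewrite ws0 mul0r => /esym/eqP; rewrite oner_eq0.
Qed.

(** The absolute value on the left makes the relation multiplicative without any
    control on the signs of the factors; it disappears at the end, where [p] is
    positive on [[-1, 1]]. *)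
Definition circle_sqnorm (R : realType) (p h : {poly R}) :=
  forall z : R[i], unit_circle z ->
    `|p.[complex.Re z]%:C| = `|(map_poly (real_complex R) h).[z]| ^+ 2.

Lemma circle_sqnormM (R : realType) (p p' h h' : {poly R}) :
  circle_sqnorm p h -> circle_sqnorm p' h' -> circle_sqnorm (p * p') (h * h').
Proof.
move=> ph p'h' z z1; rewrite hornerM rmorphM normrM ph// p'h'//.
by rewrite rmorphM /= hornerM normrM exprMn.
Qed.

Lemma circle_sqnormC (R : realType) (c : R) :
  circle_sqnorm c%:P (Num.sqrt `|c|)%:P.
Proof.
move=> z _; rewrite map_polyC /= !hornerC -normrX -rmorphXn /= sqr_sqrtr//.
by rewrite !normc_def /= expr0n /= !addr0 !sqrtr_sqr normr_id.
Qed.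

Lemma circle_sqnormZ (R : realType) (c : R) (p h : {poly R}) :
  0 < c -> circle_sqnorm (c *: p) h ->
  circle_sqnorm p ((Num.sqrt c^-1) *: h).
Proof.
move=> c_gt0 cph; have := circle_sqnormM (circle_sqnormC c^-1) cph.
by rewrite !mul_polyC scalerA mulVf ?gt_eqF// scale1r gtr0_norm ?invr_gt0.
Qed.

(** Here [r] is real, so that the two factors in [norm_Joukowski] coincide and
    [X - r] is, up to a scalar, the required polynomial. *)
Lemma fejer_riesz_linear (R : realType) (a : R) :
  ~~ (-1 <= a <= 1) ->
  exists2 h : {poly R}, size h = 2%N & circle_sqnorm ('X - a%:P) h.
Proof.
move=> /real_quadratic_root[r r0 ra].
have c_gt0 : 0 < 2 * `|r| by rewrite mulr_gt0// normr_gt0.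
exists (Num.sqrt (2 * `|r|)^-1 *: ('X - r%:P)).
  by rewrite size_scale ?size_XsubC// gt_eqF// sqrtr_gt0 invr_gt0.
apply: (circle_sqnormZ c_gt0) => z z1.
have raC : r%:C ^+ 2 + 1 = 2 * a%:C * r%:C.
  rewrite -(rmorph1 (real_complex R)) -(rmorph_nat (real_complex R) 2).
  by rewrite -!rmorphXn -!rmorphM -rmorphD/= ra.
have := norm_Joukowski z1 raC.
rewrite conjc_real => zr; rewrite rmorphB /= map_polyX map_polyC /=.
rewrite hornerXsubC expr2 -zr.
rewrite hornerZ hornerXsubC rmorphM normrM rmorphB; congr (_ * _).
by rewrite !normc_def /= expr0n /= !addr0 !sqrtr_sqr gtr0_norm// rmorphM rmorph_nat.
Qed.

(** The quadratic is [(X - w)(X - w')], with [w'] the conjugate of [w]; its value at [Re z] is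
    [|Re z - w|^2]; the square of [norm_Joukowski] leads to the real polynomial
    [(X - r)(X - r')], with [r'] the conjugate of [r]. *)
Lemma fejer_riesz_quadratic (R : realType) (w : R[i]) :
  exists2 h : {poly R}, size h = 3%N &
  circle_sqnorm (('X - (complex.Re w)%:P) ^+ 2 + ((complex.Im w) ^+ 2)%:P) h.
Proof.
have [r r0 rw] := complex_quadratic_root w.
pose n2 := (complex.Re r) ^+ 2 + (complex.Im r) ^+ 2.
have n2E : n2%:C = `|r| ^+ 2 := add_Re2_Im2 r.
have n2_gt0 : 0 < 4 * n2.
  by rewrite mulr_gt0// -ltcR n2E exprn_gt0// normr_gt0.
exists (Num.sqrt (4 * n2)^-1 *: ('X ^+ 2 - (2 * complex.Re r) *: 'X + n2%:P)).
  rewrite size_scale; last by rewrite gt_eqF// sqrtr_gt0 invr_gt0.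
  rewrite -addrA size_polyDl size_polyXn//.
  rewrite (leq_ltn_trans (size_polyD _ _))// gtn_max size_polyN.
  rewrite (leq_ltn_trans (size_scale_leq _ _)) ?size_polyX//.
  by rewrite (leq_ltn_trans (size_polyC_leq1 _)).
apply: (circle_sqnormZ n2_gt0) => z z1.
have := congr1 (fun t => t ^+ 2) (norm_Joukowski z1 rw).
have hE : (z - r) * (z - r^*%C) =
    (map_poly (real_complex R) ('X^2 - (2 * complex.Re r) *: 'X + n2%:P)).[z].
  rewrite rmorphD rmorphB /= map_polyXn map_polyZ map_polyX map_polyC/= n2E.
  rewrite !hornerE sqr_normc rmorphM rmorph_nat /= -addcJ; ring.
rewrite -normrM hE => <-.
rewrite !exprMn -n2E -add_Re2_Im2 -(rmorph_nat (real_complex R)) -rmorphXn -!rmorphM/=.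
rewrite !hornerE /= normc_def/= expr0n/= addr0 sqrtr_sqr ger0_norm.
  by congr (_%:C); case: (w) => u v /=; ring.
by rewrite mulr_ge0 ?(ltW n2_gt0)// addr_ge0// sqr_ge0.
Qed.

(** The remainder of the division by the minimal polynomial of [w] is a real
    polynomial of degree at most 1 with a nonreal root, hence it is 0. *)
Lemma nonreal_root_factor (R : realType) (p : {poly R}) (w : R[i]) :
  complex.Im w != 0 -> root (map_poly (real_complex R) p) w ->
  exists s, p = s * (('X - (complex.Re w)%:P) ^+ 2 + ((complex.Im w) ^+ 2)%:P).
Proof.
set q := _ + _ => w_nonreal /rootP pw0.
have qE : q = 'X ^+ 2 + ((- (complex.Re w *+ 2)) *: 'X
    + ((complex.Re w) ^+ 2 + (complex.Im w) ^+ 2)%:P).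
  by rewrite /q -mul_polyC; ring.
have sq : size q = 3%N.
  rewrite qE size_polyDl size_polyXn// (leq_ltn_trans (size_polyD _ _))//.
  rewrite gtn_max (leq_ltn_trans (size_scale_leq _ _)) ?size_polyX//.
  by rewrite (leq_ltn_trans (size_polyC_leq1 _)).
have q0 : q != 0 by rewrite -size_poly_eq0 sq.
have qw0 : (map_poly (real_complex R) q).[w] = 0.
  rewrite /q rmorphD rmorphXn rmorphB /= map_polyX !map_polyC /= !hornerE.
  apply/eqP; case: (w) => u v; rewrite eq_complex /=.
  by apply/andP; split; apply/eqP; ring.
exists (divp p q); rewrite {1}(divp_eq p q).
have : (size (modp p q) <= 2)%N by rewrite -ltnS -sq ltn_modp.
have : (map_poly (real_complex R) (modp p q)).[w] = 0.
  move: pw0; rewrite {1}(divp_eq p q) rmorphD rmorphM /= hornerD hornerM qw0.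
  by rewrite mulr0 add0r.
move: (modp p q) => r rw0 sr.
move: rw0; rewrite (horner_coef_wide _ (n := 2)) ?size_map_poly//.
rewrite big_ord_recl big_ord1 /= !coef_map /= mulr1 expr1 => rw0.
have r1 : r`_1 = 0.
  move: (congr1 (@complex.Im R) rw0); rewrite raddfD /=.
  case: (w) w_nonreal => u v /= v0.
  rewrite mul0r addr0 add0r => /eqP; rewrite mulf_eq0 (negbTE v0) orbF.
  by move/eqP.
have r0 : r`_0 = 0.
  by move: rw0; rewrite r1 mul0r addr0 => -[].
suff -> : r = 0 by rewrite addr0.
apply/polyP => -[|[|i]]; rewrite coef0//.
by rewrite nth_default// (leq_trans sr).
Qed.

(** Every divisor of [p] inherits the absence of roots in [[-1, 1]], so a complex
    root of [p] allows to split off a linear or a quadratic real factor and to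
    conclude by induction on the degree.  (A root in the open interval would
    lead to a nonreal [r], for which [|z - r| |z - r^*|] is not a square.) *)
Lemma fejer_riesz (R : realType) (p : {poly R}) :
  (forall x, -1 <= x <= 1 -> p.[x] != 0) ->
  exists2 h : {poly R}, (size h <= size p)%N & circle_sqnorm p h.
Proof.
have [n] := ubnP (size p); elim: n p => // n IHn p lt_pn p_neq0.
have p0 : p != 0.
  by apply: contraTneq (p_neq0 0 _) => [->|]; rewrite ?horner0 ?eqxx//; lra.
(* The inductive step, common to both kinds of factors. *)
have IHs (s q g : {poly R}) : p = s * q -> (1 < size q)%N -> size g = size q ->
    circle_sqnorm q g ->
    exists2 h : {poly R}, (size h <= size p)%N & circle_sqnorm p h.
  move=> pE q_gt1 gq qg.
  move: (p0); rewrite pE mulf_eq0 negb_or => /andP[s0 q0].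
  have sp : size p = (size s + size q).-1 by rewrite pE size_mul.
  case: (IHn s) => [|x x1|h hs sh].
  - rewrite (leq_trans _ (_ : size p <= n)%N)// sp.
    move: q_gt1; case: (size q) => [|[|k]]// _.
    by rewrite addnS /= addnS ltnS leq_addr.
  - by move: (p_neq0 x x1); rewrite pE hornerM mulf_eq0 negb_or => /andP[].
  - exists (h * g); last exact: circle_sqnormM.
    rewrite (leq_trans (size_polyMleq _ _))// gq -pE sp.
    by rewrite -!subn1 leq_sub2r// leq_add2r.
have [/eqP p1|] := boolP (size (map_poly (real_complex R) p) == 1%N).
  rewrite size_map_poly in p1.
  have /size_poly1P[c c0 ->] : size p == 1%N by rewrite p1.
  exists (Num.sqrt `|c|)%:P; last exact: circle_sqnormC.
  by rewrite size_polyC c0 size_polyC_leq1.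
move=> /closed_rootP[w pw0]; have [w_real|w_nonreal] := eqVneq (complex.Im w) 0.
  have pa0 : root p (complex.Re w).
    by move: pw0; rewrite (complex_ReK w_real) fmorph_root.
  have /factor_theorem[s pE] := pa0.
  have [|h sh ah] := @fejer_riesz_linear R (complex.Re w).
    by apply: contraL pa0 => /p_neq0.
  by apply: (IHs _ _ h pE) => //; rewrite size_XsubC.
have [s pE] := nonreal_root_factor w_nonreal pw0.
have [h sh wh] := fejer_riesz_quadratic w.
have sq : size (('X - (complex.Re w)%:P) ^+ 2 + ((complex.Im w) ^+ 2)%:P) = 3%N.
  rewrite size_polyDl size_exp_XsubC// ltnS.
  exact: leq_trans (size_polyC_leq1 _) _.
by apply: (IHs _ _ h pE) => //; rewrite sq.
Qed.

(** * Positive trigonometric polynomials and the sublevel set *)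

Lemma unit_circle_above (R : realType) (x : R) :
  -1 <= x <= 1 -> unit_circle (x +i* Num.sqrt (1 - x ^+ 2)).
Proof.
move=> x1; rewrite /unit_circle/= normc_def/= sqr_sqrtr; last by nra.
by rewrite addrC subrK sqrtr1.
Qed.

(** Compactness of [[-1, 1]] leaves room to subtract a positive constant before
    factoring; adding it back as a multiple of the identity turns the rank-one
    Gram matrix into a positive definite one. *)
Lemma posdef_gram_exists (R : realType) (m : nat) (p : trigpoly R m) :
  tp_pos p -> exists2 A : 'M[R]_m.+1, sym_posdef A & represents A p.
Proof.
move=> p_gt0; have [t szt tE] := tp_evalE p.
have t_gt0 x : -1 <= x <= 1 -> 0 < t.[x].
  move=> x1; have := unit_circle_above x1 => z1.
  by have := p_gt0 _ z1; rewrite tE// ltcR.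
have le_N11 : -1 <= 1 :> R by lra.
have [c c1 t_min] := EVT_min le_N11 (continuous_subspaceT (@continuous_horner _ t)).
(* The identity matrix represents the constant [m.+1], and halving the minimum
   keeps the inequality strict. *)
rewrite in_itv/= in c1; pose e := t.[c] / 2 / m.+1%:R.
have e_gt0 : 0 < e by rewrite !divr_gt0 ?t_gt0.
have te_gt0 x : -1 <= x <= 1 -> 0 < (t - (e * m.+1%:R)%:P).[x].
  move=> x1; rewrite hornerD hornerN hornerC /e divfK// subr_gt0.
  have := t_min x; rewrite in_itv/= => /(_ x1); have := t_gt0 _ c1; lra.
have [|h szh hE] := @fejer_riesz _ (t - (e * m.+1%:R)%:P).
  by move=> x x1; rewrite gt_eqF// te_gt0.
exists (gram m h e); first exact: gram_sym_posdef.
move=> z z1; rewrite tr_Theta_gram//.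
  have zx := unit_circle_Re z1.
  rewrite -hE// ger0_norm ?ler0c ?ltW ?te_gt0// tE// -rmorphD/=.
  by rewrite hornerD hornerN hornerC subrK.
rewrite (leq_trans szh)// (leq_trans (size_polyD _ _))// geq_max szt/=.
by rewrite size_polyN (leq_trans (size_polyC_leq1 _)).
Qed.

(** Both sides are pointwise: a supremum is at most [eps] when all values are, and
    at a given point one multiplies by the positive value of [q]. *)
Lemma max_error_le (R : realType) (m : nat) (N : R[i] -> R) (eps : R)
    (p q : trigpoly R m) :
  tp_pos q ->
  (max_error N p q <= eps%:E)%E <->
  forall z : R[i], unit_circle z ->
    tp_eval p z - (N z + eps)%:C * tp_eval q z <= 0 /\
    0 <= tp_eval p z - (N z - eps)%:C * tp_eval q z.
Proof.
move=> q_gt0.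
have errE (z : R[i]) : unit_circle z ->
    (complex.Re `|tp_eval p z / tp_eval q z - (N z)%:C| <= eps) <->
    tp_eval p z - (N z + eps)%:C * tp_eval q z <= 0 /\
    0 <= tp_eval p z - (N z - eps)%:C * tp_eval q z.
  move=> z1; have := q_gt0 z z1.
  rewrite (complex_ReK (tp_eval_real p z1)) (complex_ReK (tp_eval_real q z1)).
  move: (complex.Re (tp_eval p z)) (complex.Re (tp_eval q z)) => a b.
  rewrite ltcR => b_gt0; rewrite -!rmorphM -!rmorphB -fmorph_div -rmorphB.
  rewrite lecR lecR normc_def /= expr0n /= addr0 sqrtr_sqr ler_distl.
  rewrite ler_pdivrMr// ler_pdivlMr// subr_ge0 subr_le0.
  by split=> [/andP[]|[-> ->]].
split=> [le_eps z z1|le_eps].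
  apply/errE => //; rewrite -lee_fin; apply: le_trans le_eps.
  by apply: ereal_sup_ubound; exists z.
by apply: ge_ereal_sup => _ [z z1 <-]; rewrite lee_fin; apply/errE; auto.
Qed.

Theorem theorem5p5 (R : realType) (m : nat) (eps : R) (N : R[i] -> R)
    (heps : 0 < eps) (hN : forall z : R[i], unit_circle z -> 0 < N z)
    (p q : trigpoly R m) :
  sublevel N eps (p, q) <->
  exists P Q : 'M[R]_m.+1,
    [/\ sym_posdef P /\ sym_posdef Q,
        represents P p /\ represents Q q,
        \tr Q = 1
      & forall z : R[i], unit_circle z ->
          tr_Theta P z - (N z + eps)%:C * tr_Theta Q z <= 0 /\
          0 <= tr_Theta P z - (N z - eps)%:C * tr_Theta Q z].
Proof.
split=> [[/= p_gt0 q_gt0 err_pq tr_q]|].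
  have [P P_pd Pp] := posdef_gram_exists p_gt0.
  have [Q Q_pd Qq] := posdef_gram_exists q_gt0.
  exists P, Q; split=> //; first by rewrite -(represents_tr Qq).
  move=> z z1; rewrite -Pp// -Qq//.
  by have /(_ z z1) := (max_error_le N eps p q_gt0).1 err_pq.
move=> [P [Q [[P_pd Q_pd] [Pp Qq] tr_Q err_PQ]]].
have p_gt0 := sym_posdef_tp_pos P_pd Pp.
have q_gt0 := sym_posdef_tp_pos Q_pd Qq.
split=> //=; last by rewrite (represents_tr Qq).
by apply/(max_error_le _ _ _ q_gt0) => z z1; rewrite Pp// Qq//; exact: err_PQ.
Qed.
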